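(* Let $n$ be a positive integer and let $D_{2n}$ be the dihedral group of order $2n$. Then $\eta(D_{2n})=\tau(n)$ when $n$ is even, and $\eta(D_{2n})=\tau(n)+1$ when $n$ is odd.
   Context: For a finite group $G$, $\omega(G)$ denotes the set of orders of elements of $G$ and $\eta(G)=|\omega(G)|$. $\tau(n)$ is the number of positive divisors of $n$. The subscript in $D_{2n}$ is the order of the group: $D_{2n}$ consists of a cyclic rotation subgroup of order $n$ together with $n$ reflections, each of order $2$, that is, $D_{2n}=\langle r,s\mid r^n=s^2=1,\ srs^{-1}=r^{-1}\rangle$. *)

(* Defs.v *)
From mathcomp Require Import all_boot all_fingroup all_solvable.
From mathcomp Require Import finmap.

Set Implicit Arguments.
Unset Strict Implicit.
Unset Printing Implicit Defensive.

Local Open Scope group_scope.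

Definition omega (gT : finGroupType) (G : {group gT}) : {fset nat} :=
  [fset #[x] | x in G]%fset.

Definition eta (gT : finGroupType) (G : {group gT}) : nat := #|` omega G|%fset.

Definition tau (n : nat) : nat := size (divisors n).

(* _ \isog Grp _ compares G with the largest finite quotient of the presented
   group; for n > 0 the latter is itself finite, of order 2n, so this says that
   G is isomorphic to it.  The type 'D_(n.*2) of mathcomp is the dihedral group
   of order 2n only for n > 1, whereas this also covers n = 1. *)
Definition is_dihedral (n : nat) (gT : finGroupType) (G : {group gT}) : Prop :=
  G \isog Grp (r : s : r ^+ n, s ^+ 2, s * r * s^-1 = r^-1).

(* Main.v *)
Require Import Defs.
From mathcomp Require Import all_boot all_fingroup all_solvable.
From mathcomp Require Import zmodp finmap.

(** A rotation subgroup [<[r]>] of order [n] contributes exactly the divisors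
    of [n] to the set of element orders, and every element outside it is a
    reflection, of order 2.  Hence [omega G] consists of the divisors of [n]
    together with 2, and 2 is already a divisor precisely when [n] is even.

    The point that needs an argument is that the presentation does not
    collapse: its relations only say that the order of [r] divides [n].  They
    give the upper bound [#|G| <= 2n], and a concrete group of order [2n]
    satisfying the same relations is a quotient of [G], so [#|G| = 2n]; this
    forces [#[r] = n] and [s \notin <[r]>] ([dihedral_generators]). *)

Set Implicit Arguments.
Unset Strict Implicit.
Unset Printing Implicit Defensive.

Local Open Scope group_scope.

Section DihedralOrders.

Variables (gT : finGroupType).
Implicit Types (G : {group gT}) (n : nat).

Lemma dihedral_homP n G :
  reflect (exists r s : gT, [/\ <[r]> <*> <[s]> = G, r ^+ n = 1, s ^+ 2 = 1
                              & s * r * s^-1 = r^-1])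
          (G \homg Grp (r : s : r ^+ n, s ^+ 2, s * r * s^-1 = r^-1)).
Proof.
apply: (iffP existsP) => [[[r s]] /= | [r [s [defG rn s2 rs]]]].
  rewrite !xpair_eqE => /andP[/eqP defG /and3P[/eqP rn /eqP s2 /eqP rs]].
  by exists r, s.
by exists (r, s); rewrite /= !xpair_eqE defG rn s2 rs !eqxx.
Qed.

(** The two orientations of conjugation by [s] agree because [s] is its own
    inverse; the notation [_ ^ s] stands for [s^-1 * _ * s]. *)
Lemma invol_conj_inv (r s : gT) :
  s ^+ 2 = 1 -> (s * r * s^-1 = r^-1 <-> r ^ s = r^-1).
Proof.
move=> s2; have sV : s^-1 = s by apply/eqP; rewrite eq_invg_mul -expg2 s2.
by rewrite conjgE sV mulgA.
Qed.

End DihedralOrders.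

(** This is the witness that the presented group is not smaller than [2n].
    The case [n = 1] stands apart because ['D_m] is dihedral of order [m] only
    for [m >= 4]; there the presentation is that of the group of order 2. *)
Lemma dihedral_model n : 0 < n ->
  exists (rT : finGroupType) (D : {group rT}),
    #|D| = n.*2 /\ D \homg Grp (r : s : r ^+ n, s ^+ 2, s * r * s^-1 = r^-1).
Proof.
rewrite leq_eqVlt => /orP[/eqP <- | n_gt1].
  exists _, [set: 'Z_2]%G.
  split; first by rewrite cardsT card_ord.
  apply/dihedral_homP; exists 1, Zp1; split.
  - by rewrite cycle1 joing1G [RHS](Zp_cycle 1).
  - by rewrite expg1.
  - exact/eqP.
  - exact/eqP.
exists _, [set: 'D_(n.*2)]%G; rewrite card_dihedral //; split=> //.
have /existsP[[x y]] := isoGrp_hom (Grp_dihedral n_gt1).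
rewrite /= !xpair_eqE => /andP[/eqP defD /and3P[/eqP xn /eqP y2 /eqP xy]].
by apply/dihedral_homP; exists x, y; split=> //; apply/invol_conj_inv.
Qed.

Section DihedralElements.

Variables (gT : finGroupType) (G : {group gT}) (n : nat).

(** Two bounds on the order of [G] meet.  The relations make [<[r]>] normal,
    so [G] is the product [<[r]> * <[s]>] of cyclic groups of orders at most
    [n] and 2; the universal property makes the model of order [2n] a quotient
    of [G].  If [s] were a rotation, [G = <[r]>] would be too small. *)
Lemma dihedral_generators : 0 < n -> is_dihedral n G ->
  exists r s : gT, [/\ <[r]> * <[s]> = G, #[r] = n, s \notin <[r]>,
                       s ^+ 2 = 1 & r ^ s = r^-1].
Proof.
move=> n_gt0 dihG.
have /dihedral_homP[r [s [defG rn s2 /(invol_conj_inv _ s2) rs]]] :=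
  isoGrp_hom dihG.
have dvd_r : #[r] %| n by rewrite order_dvdn rn.
have dvd_s : #[s] %| 2 by rewrite order_dvdn s2.
have nrs : <[s]> \subset 'N(<[r]>) by rewrite norms_cycle rs groupV cycle_id.
have mulG : <[r]> * <[s]> = G by rewrite -norm_joinEr.
have leGn : n.*2 <= #|G|.
  have [rT [D [oD homD]]] := dihedral_model n_gt0.
  by rewrite -oD dvdn_leq // card_homg // dihG.
have le_mul : #|G| <= #[r] * #[s].
  by rewrite -mulG !orderE mul_cardG leq_pmulr // cardG_gt0.
have or_le := dvdn_leq n_gt0 dvd_r; have os_le := dvdn_leq (isT : 0 < 2) dvd_s.
have or : #[r] = n.
  apply/eqP; rewrite eqn_leq or_le -(leq_pmul2r (isT : 0 < 2)) muln2.
  by rewrite (leq_trans leGn) // (leq_trans le_mul) // leq_mul2l os_le orbT.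
exists r, s; split=> //; apply/negP=> rot_s.
have: n.*2 <= n.
  by rewrite (leq_trans leGn) // -mulG mulGSid ?cycle_subG // -orderE or.
by rewrite leqNgt -addnn -{1}[n]addn0 ltn_add2l n_gt0.
Qed.

(** A rotation times a reflection squares to 1, because the reflection inverts
    the rotation. *)
Lemma order_reflection (r s : gT) i :
  s \notin <[r]> -> s ^+ 2 = 1 -> r ^ s = r^-1 -> #[r ^+ i * s] = 2.
Proof.
move=> nrot_s s2 rs; apply: nt_prime_order => //.
  have ->: (r ^+ i * s) ^+ 2 = r ^+ i * (s ^+ 2 * (r ^+ i) ^ s).
    by rewrite conjgE !expg2 !mulgA mulgK.
  by rewrite s2 mul1g conjXg rs expgVn mulgV.
apply: contra nrot_s => /eqP/(canRL (mulKg _)) ->.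
by rewrite mulg1 groupV mem_cycle.
Qed.

Lemma mem_omega_dihedral (k : nat) : 0 < n -> is_dihedral n G ->
  (k \in omega G) = (k == 2) || (k %| n).
Proof.
move=> n_gt0 /(dihedral_generators n_gt0)[r [s [defG or nrot_s s2 rs]]].
apply/imfsetP/orP => /= [[x] | [/eqP-> | dvd_k]].
- rewrite -defG => /mulsgP[_ _ /cycleP[i ->] /cycleP[j ->] ->] ->.
  rewrite -(expg_mod _ s2) modn2; case: (odd j); first last.
    by right; rewrite mulg1 -or order_dvdG ?mem_cycle.
  by left; rewrite expg1 order_reflection.
- exists s; last by rewrite -[s]mul1g (order_reflection (r := r) 0).
  by rewrite -defG (subsetP (mulG_subr _ _)) ?cycle_id.
exists (r ^+ (n %/ k)).
  by rewrite -defG (subsetP (mulG_subl _ _)) ?mem_cycle.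
rewrite orderXdiv or ?dvdn_div //.
by rewrite divnA // mulKn.
Qed.

End DihedralElements.

Theorem proposition7p1 (n : nat) (gT : finGroupType) (G : {group gT}) :
  0 < n -> is_dihedral n G ->
  (~~ odd n -> eta G = tau n) /\ (odd n -> eta G = tau n + 1).
Proof.
move=> n_gt0 dihG.
have om k : (k \in omega G) = (k == 2) || (k \in divisors n).
  by rewrite -dvdn_divisors // (mem_omega_dihedral _ n_gt0 dihG).
rewrite /eta /tau.
have sizeP (t : seq nat) : uniq t -> omega G =i t -> #|` omega G|%fset = size t.
  by move=> t_uniq eq_t; apply/eqP; rewrite -uniq_size_uniq // fset_uniq.
split=> n_par; last rewrite addn1 -[RHS]/(size (2 :: divisors n)).
  apply: sizeP (divisors_uniq n) _ => k; rewrite om.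
  by case: eqP => [-> | //]; rewrite -dvdn_divisors // dvdn2 n_par.
apply: sizeP => [|k]; last by rewrite om inE.
by rewrite /= divisors_uniq -dvdn_divisors // dvdn2 n_par.
Qed.
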